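(* Let $N\ge 1$, $p>1$, and let $J\in C_0^\infty(\mathbb{R}^N)$ be radially symmetric with $J\ge 0$ and $\int_{\mathbb{R}^N}J=1$. Suppose $0\le u_0\in L^\infty(\mathbb{R}^N)$ satisfies $$|x|^{\frac{2}{p-1}}u_0(x)\to\infty\quad\text{as }|x|\to\infty .$$ Let $u(x,t)$ be the bounded solution of $$u_t=\mathcal{L}u-u^p\ \text{ in }\mathbb{R}^N\times(0,\infty),\qquad u(x,0)=u_0(x)\ \text{ in }\mathbb{R}^N,$$ where $\mathcal{L}u(x,t)=\int_{\mathbb{R}^N}J(x-y)\,(u(y,t)-u(x,t))\,dy$. Then, for every constant $k>0$, $$\lim_{t\to\infty}t^{\frac1{p-1}}u(x,t)=\Big(\frac1{p-1}\Big)^{\frac1{p-1}}$$ uniformly on the sets $\{x\in\mathbb{R}^N:|x|\le k\sqrt t\}$, that is, $$\lim_{t\to\infty}\ \sup_{|x|\le k\sqrt t}\Big|t^{\frac1{p-1}}u(x,t)-\Big(\frac1{p-1}\Big)^{\frac1{p-1}}\Big|=0 .$$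
   Context: $C_0^\infty(\mathbb{R}^N)$ denotes smooth compactly supported functions. The datum $u_0$ is regarded as a bounded measurable function defined at every point. The bounded solution $u$ is the unique bounded (and nonnegative) measurable function on $\mathbb{R}^N\times[0,\infty)$ such that for every $x$ the map $t\mapsto u(x,t)$ is continuously differentiable on $[0,\infty)$, the equation holds pointwise, and $u(x,0)=u_0(x)$. *)

(* Defs.v *)
From HB Require Import structures.
From mathcomp Require Import all_boot all_order all_algebra.
From mathcomp Require Import all_classical all_reals all_analysis.

Set Implicit Arguments.
Unset Strict Implicit.
Unset Printing Implicit Defensive.
Import Order.TTheory GRing.Theory Num.Theory.
Import numFieldNormedType.Exports.

Local Open Scope classical_set_scope.
Local Open Scope ring_scope.

(* R^n is 'rV[R]_n.  The library's norm [`|x|] on it is the sup norm (which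
   gives the usual topology); the Euclidean length is [enorm]. *)

Definition enorm (R : realType) (n : nat) (x : 'rV[R]_n) : R :=
  Num.sqrt (\sum_(i < n) x ord0 i ^+ 2).

(* The product (= Borel) sigma-algebra of 'rV[R]_n, built as the library does
   for n.-tuple R. *)

Section measurable_rV.
Variables (R : realType) (n : nat).

Definition coord_rV (i : 'I_n) (x : 'rV[R]_n) : measurableTypeR R := x ord0 i.

Let rV_set0 : g_sigma_preimage coord_rV set0.
Proof. exact: sigma_algebra0. Qed.

Let rV_setC A : g_sigma_preimage coord_rV A -> g_sigma_preimage coord_rV (~` A).
Proof. exact: sigma_algebraC. Qed.

Let rV_bigcup (F : (set 'rV[R]_n)^nat) :
  (forall i, g_sigma_preimage coord_rV (F i)) ->
  g_sigma_preimage coord_rV (\bigcup_i (F i)).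
Proof. exact: sigma_algebra_bigcup. Qed.

HB.instance Definition _ := @isMeasurable.Build default_measure_display
  'rV[R]_n (g_sigma_preimage coord_rV) rV_set0 rV_setC rV_bigcup.

Lemma measurable_coord_rV (i : 'I_n) :
  measurable_fun [set: 'rV[R]_n] (coord_rV i).
Proof.
move=> _ Y mY; rewrite setTI; apply: sub_sigma_algebra => /=.
rewrite -bigcup_seq/=; exists i => /=; first by rewrite mem_index_enum.
by exists Y => //; rewrite setTI.
Qed.

Lemma measurable_fun_rV d (T : measurableType d) (f : T -> 'rV[R]_n) :
  (forall i, measurable_fun setT (coord_rV i \o f)) -> measurable_fun setT f.
Proof.
move=> mf.
suff H : measurable `<=` [set A | measurable (f @^-1` A)].
  by move=> _ A mA; rewrite setTI; exact: H.
apply: smallest_sub.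
  split => [|A|F] /=.
  - by rewrite preimage_set0.
  - by move=> mA; rewrite setTD preimage_setC; exact: measurableC.
  - by move=> mF; rewrite preimage_bigcup; exact: bigcupT_measurable.
move=> A; rewrite -bigcup_seq => -[i _ [B mB <-]] /=.
by rewrite setTI -comp_preimage -[X in measurable X]setTI; exact: mf.
Qed.

End measurable_rV.

Section lebesgue_rV.
Variable R : realType.

Definition cons_rV (n : nat) (z : measurableTypeR R * 'rV[R]_n) : 'rV[R]_n.+1 :=
  row_mx (const_mx z.1 : 'rV[R]_1) z.2.

Lemma cons_rV0 n z : @cons_rV n z ord0 ord0 = z.1.
Proof.
transitivity ((const_mx z.1 : 'rV[R]_1) ord0 ord0); last by rewrite mxE.
rewrite -(row_mxEl (const_mx z.1 : 'rV[R]_1) z.2 ord0 ord0).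
by congr (row_mx _ _ _ _); exact: val_inj.
Qed.

Lemma cons_rVS n z (i : 'I_n) : @cons_rV n z ord0 (lift ord0 i) = z.2 ord0 i.
Proof.
rewrite -(row_mxEr (const_mx z.1 : 'rV[R]_1) z.2 ord0 i).
by congr (row_mx _ _ _ _); exact: val_inj.
Qed.

Lemma measurable_cons_rV n : measurable_fun setT (@cons_rV n).
Proof.
apply: measurable_fun_rV => i; case: (unliftP ord0 i) => [j ->|->].
  rewrite (_ : _ \o _ = coord_rV j \o snd); last first.
    by apply/funext => z /=; rewrite /coord_rV cons_rVS.
  exact: measurableT_comp (@measurable_coord_rV R n j) measurable_snd.
rewrite (_ : _ \o _ = fst) //.
by apply/funext => z /=; rewrite /coord_rV cons_rV0.
Qed.

Section step.
Variables (n : nat) (m : {sigma_finite_measure set 'rV[R]_n -> \bar R}).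

Definition lebesgue_rV_step : set 'rV[R]_n.+1 -> \bar R :=
  pushforward (lebesgue_measure \x m)%E (@cons_rV n).

Let measurable_preimage A : measurable A -> measurable (@cons_rV n @^-1` A).
Proof. by move=> mA; rewrite -[X in measurable X]setTI; exact: measurable_cons_rV. Qed.

Let step0 : lebesgue_rV_step set0 = 0%E.
Proof. by rewrite /lebesgue_rV_step /pushforward preimage_set0 measure0. Qed.

Let step_ge0 A : (0 <= lebesgue_rV_step A)%E.
Proof. by rewrite /lebesgue_rV_step /pushforward; apply: measure_ge0. Qed.

Let step_sigma_additive : semi_sigma_additive lebesgue_rV_step.
Proof.
move=> F mF tF mUF; rewrite /lebesgue_rV_step /pushforward preimage_bigcup.
apply: measure_semi_sigma_additive.
- by move=> k; exact: measurable_preimage.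
- apply/trivIsetP => /= i j _ _ ij; rewrite -preimage_setI.
  by rewrite (trivIsetP.1 tF) ?preimage_set0.
- by rewrite -preimage_bigcup; exact: measurable_preimage.
Qed.

HB.instance Definition _ := isMeasure.Build _ _ _ lebesgue_rV_step
  step0 step_ge0 step_sigma_additive.

Let uncons (x : 'rV[R]_n.+1) : measurableTypeR R * 'rV[R]_n :=
  (x ord0 ord0, \row_i x ord0 (lift ord0 i)).

Let measurable_uncons : measurable_fun setT uncons.
Proof.
apply/measurable_fun_pairP; split; first exact: (@measurable_coord_rV R n.+1 ord0).
apply: measurable_fun_rV => i.
rewrite (_ : _ \o _ = coord_rV (lift ord0 i)); first exact: measurable_coord_rV.
by apply/funext => x /=; rewrite /coord_rV mxE.
Qed.

Let cons_rVK : cancel (@cons_rV n) uncons.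
Proof.
move=> [a x]; rewrite /uncons cons_rV0; congr pair.
by apply/rowP => i; rewrite mxE cons_rVS.
Qed.

Let step_sigma_finite : sigma_finite setT lebesgue_rV_step.
Proof.
have [F TF Foo] : sigma_finite setT (lebesgue_measure \x m)%E.
  have /sigma_finiteP[F [TF ndF Foo]] := sigma_finiteT (@lebesgue_measure R).
  have /sigma_finiteP[G [TG ndG Goo]] := sigma_finiteT m.
  exists (fun k => F k `*` G k).
    rewrite -setXTT TF TG predeqE => -[x y]; split.
      move=> [/= [k _ Fkx] [l _ Gly]]; exists (maxn k l) => //; split.
      - by move: x Fkx; exact/subsetPset/ndF/leq_maxl.
      - by move: y Gly; exact/subsetPset/ndG/leq_maxr.
    by move=> [k _ []/= ? ?]; split; exists k.
  move=> k; have [? ?] := Foo k; have [? ?] := Goo k.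
  split; first exact: measurableX.
  by rewrite product_measure1E// lte_mul_pinfty// ge0_fin_numE.
exists (fun k => uncons @^-1` F k); first by rewrite -preimage_bigcup -TF preimage_setT.
move=> k; have [mFk Fkoo] := Foo k; split.
  by rewrite -[X in measurable X]setTI; exact: measurable_uncons.
rewrite /lebesgue_rV_step /pushforward -comp_preimage.
by rewrite (_ : uncons \o @cons_rV n = id) //; apply/funext => z /=; rewrite cons_rVK.
Qed.

HB.instance Definition _ := Measure_isSigmaFinite.Build _ _ _ lebesgue_rV_step
  step_sigma_finite.

End step.

(* n-dimensional Lebesgue measure on Borel sets: the product of n copies of the
   one-dimensional one. *)
Fixpoint lebesgue_rV (n : nat) : {sigma_finite_measure set 'rV[R]_n -> \bar R} :=
  match n with
  | 0 => \d_(0 : 'rV[R]_0)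
  | n.+1 => lebesgue_rV_step (lebesgue_rV n)
  end.

End lebesgue_rV.

(* R^n with the sigma-algebra of Lebesgue-measurable sets, and the (complete)
   Lebesgue measure on it. *)

Definition lebesgue_space (R : realType) (n : nat) : measurableType _ :=
  caratheodory_type (lebesgue_rV R n)^*%mu.

Definition lebesgue_mu (R : realType) (n : nat) :
    {measure set (lebesgue_space R n) -> \bar R} :=
  @completed_measure_extension _ _ R (lebesgue_rV R n).

(* C^k as: all partial derivatives of order at most k exist and are continuous. *)
Fixpoint Ck (R : realType) (n k : nat) (f : 'rV[R]_n -> R) : Prop :=
  match k with
  | 0 => continuous f
  | k.+1 => continuous f /\ forall i : 'I_n,
      (forall x, derivable f x (delta_mx ord0 i)) /\
      Ck k (fun x => 'D_(delta_mx ord0 i) f x)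
  end.

Definition smooth (R : realType) (n : nat) (f : 'rV[R]_n -> R) : Prop :=
  forall k, Ck k f.

Definition compactly_supported (R : realType) (n : nat) (f : 'rV[R]_n -> R) :
    Prop :=
  compact (closure [set x | f x != 0]).

Definition radially_symmetric (R : realType) (n : nat) (f : 'rV[R]_n -> R) :
    Prop :=
  forall x y, enorm x = enorm y -> f x = f y.

Definition nonlocal (R : realType) (n : nat) (J v : 'rV[R]_n -> R)
    (x : 'rV[R]_n) : R :=
  \int[lebesgue_mu R n]_y (J (x - y) * (v y - v x)).

(* C^1 on the closed half-line [0, +oo), one-sided at 0. *)
Definition C1_half_line (R : realType) (f : R -> R) : Prop :=
  exists g : R -> R, {within `[0, +oo[, continuous g} /\
    forall t : R, 0 <= t ->
      (f s - f t) / (s - t) @[s --> within `[0, +oo[ t^'] --> g t.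

(* [u] is the bounded solution of u_t = L u - u^p, u(., 0) = u0; only its values
   at times t >= 0 are relevant.  Measurability is with respect to the product
   of the Lebesgue sigma-algebra in x and the Borel one in t: as u is continuous
   in t, this amounts to Lebesgue measurability on R^n x [0, +oo). *)
Record bounded_solution (R : realType) (n : nat) (p : R) (J u0 : 'rV[R]_n -> R)
    (u : 'rV[R]_n -> R -> R) : Prop := {
  solution_measurable : measurable_fun
    ([set: lebesgue_space R n] `*` (`[0, +oo[ : set R))
    (fun z : lebesgue_space R n * R => u z.1 z.2) ;
  solution_bounded : exists M : R, forall x (t : R), 0 <= t -> `|u x t| <= M ;
  solution_ge0 : forall x (t : R), 0 <= t -> 0 <= u x t ;
  solution_C1 : forall x, C1_half_line (u x) ;
  solution_eq : forall x (t : R), 0 < t ->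
    derive1 (u x) t = nonlocal J (u ^~ t) x - u x t `^ p ;
  solution_init : forall x, u x 0 = u0 x }.

(* Main.v *)
(* With q = 1/(p-1), m = int J(z)|z|^2 dz and positive c, eps, the function
     v(x,t) = a(x,t)^(-q),  a = c + eps |x|^2 + (p - 1 + eps m) t,
   is a subsolution: L|x|^2 = m gives a_t = L a + (p - 1), and s |-> s^(-q) is
   convex, so L v >= -q a^(-q-1) L a. The decay hypothesis puts v(.,0) below the
   solution at some positive time for every eps, once the solution is known to
   be positive on the ball where u_0 may vanish. On |x| <= k sqrt t this gives
   t^q u >= (p - 1 + eps (k^2 + m) + o(1))^(-q). The case eps = 0 is a spatially
   constant solution lying above u, whence t^q u <= (p - 1)^(-q). *)

Require Import Defs.
From mathcomp Require Import all_boot all_order all_algebra.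
From mathcomp Require Import all_classical all_reals all_analysis.
From mathcomp Require Import measurable_realfun ring lra.
Import Order.TTheory GRing.Theory Num.Theory.
Import numFieldNormedType.Exports.

Set Implicit Arguments.
Unset Strict Implicit.
Unset Printing Implicit Defensive.

Local Open Scope classical_set_scope.
Local Open Scope ring_scope.

(** * Comparison with a family of ordinary differential inequalities *)

(** The solution is only measurable in [x] and space is unbounded, so a difference [d] of two
    competitors need not attain a maximum. Comparison is therefore run as an ordinary differential
    inequality at each point, and the points are coupled only through the supremum [D] of [d]. As
    [J] is a probability density, [L d <= D - d]. The absorption terms have the favourable sign
    wherever [d > 0], so [d' <= D - d] is needed only there. The waiting time that makes [u]
    positive on the ball depends on [u0] and [J] but not on [eps]. During that time [u] loses at
    most an exponential factor against [u0], and the decay hypothesis can absorb this factor because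
    it holds with every constant. *)

(** By continuity the supremum [s] of the times at which [f <= 0] is itself such a time. After [s]
    the function is positive, hence nonincreasing, so it cannot rise above [f s]. *)
Lemma barrier_le0 (R : realType) (f : R -> R) (a b : R) : a <= b ->
  {within `[a, b], continuous f} ->
  (forall t, t \in `]a, b[ -> derivable f t 1) ->
  (forall t, t \in `]a, b[ -> 0 < f t -> derive1 f t <= 0) ->
  f a <= 0 -> f b <= 0.
Proof.
move=> ab cf df df0 fa0.
pose S := [set t | t \in `[a, b] /\ f t <= 0].
have Sa : S a by split; rewrite ?in_itv/= ?lexx.
have Sb : ubound S b by move=> t [+ _]; rewrite in_itv/= => /andP[].
have supS : has_sup S by split; [exists a|exists b].
pose s := sup S.
have sab : s \in `[a, b].
  rewrite in_itv/=; apply/andP; split; first exact: sup_upper_bound.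
  by apply: ge_sup => //; exists a.
have fs0 : f s <= 0.
  rewrite leNgt; apply/negP => fs0.
  have /subspace_continuousP/(_ s sab) cfs := cf.
  have : \forall t \near within [set` `[a, b]] (nbhs s), 0 < f t.
    exact: (cfs [set y | 0 < y] (lt_nbhsr fs0)).
  rewrite /within/= => /nbhs_ballP[e /= e0 se].
  have [t [tab ft0] st] := sup_adherent e0 supS.
  have ts : t <= s by exact: sup_upper_bound.
  have := se t _ tab; rewrite ltNge ft0 => /(_ _)/negP; apply => //.
  by rewrite /ball/= ger0_norm ?subr_ge0// ltrBlDl -ltrBlDr.
have /andP[as_ sb] : (a <= s) && (s <= b) by move: sab; rewrite in_itv.
have pos t : t \in `]s, b[ -> 0 < f t.
  rewrite in_itv/= => /andP[st tb]; rewrite ltNge; apply/negP => ft0.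
  have : t <= s.
    apply: sup_upper_bound => //; split => //.
    by rewrite in_itv/= (le_trans as_ (ltW st)) ltW.
  by rewrite leNgt st.
have sub t : t \in `]s, b[ -> t \in `]a, b[.
  by rewrite !in_itv/= => /andP[st ->]; rewrite (le_lt_trans as_ st).
apply: le_trans fs0.
apply: (@ler0_derive1_le_cc _ f s b) => //.
- by move=> t /sub; exact: df.
- by move=> t tsb; apply: df0; [exact: sub|exact: pos].
- by apply: (continuous_subspaceW _ cf); apply: subset_itvr; rewrite bnd_simp.
- by rewrite in_itv/= sb lexx.
- by rewrite in_itv/= sb lexx.
Qed.

(* If [D] is the supremum of [d], every [d x] stays below
   [D * (1 - exp (t0 - t))], which forces [D <= 0]. *)
Lemma comparison_principle (R : realType) (X : Type) (S : X -> Prop)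
    (t0 t1 : R) (d d' : X -> R -> R) :
  (exists M : R, forall x t, S x -> t0 <= t <= t1 -> d x t <= M) ->
  (forall x, S x -> {within `[t0, t1], continuous (d x)}) ->
  (forall x t, S x -> t0 < t < t1 -> is_derive t 1 (d x) (d' x t)) ->
  (forall x t D, S x -> t0 < t < t1 -> 0 < d x t ->
     (forall y, S y -> d y t <= D) -> d' x t <= D - d x t) ->
  (forall x, S x -> d x t0 <= 0) ->
  forall x t, S x -> t0 <= t <= t1 -> d x t <= 0.
Proof.
move=> [M dM] cd isd dd' d0 x t Sx tt.
(* Adjoining 0 makes [E] nonempty and gives [0 <= D]. *)
pose E := [set r | r = 0 \/ exists x t, [/\ S x, t0 <= t <= t1 & r = d x t]].
have E0 : E 0 by left.
have hE : has_sup E.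
  split; first by exists 0.
  exists (Num.max 0 M) => r [->|[y [s [Sy st ->]]]]; rewrite le_max ?lexx//.
  by rewrite dM ?orbT.
pose D := sup E.
have D0 : 0 <= D by apply: sup_upper_bound.
have dD y s : S y -> t0 <= s <= t1 -> d y s <= D.
  by move=> Sy st; apply: sup_upper_bound => //; right; exists y, s.
have key y s : S y -> t0 <= s <= t1 -> d y s <= D * (1 - expR (t0 - s)).
  move=> Sy /andP[t0s st1].
  (* Integrating factor for [d' <= D - d], shifted so that [g t0 = d y t0]. Since [d <= D] and the
     exponential is at least 1, [g > 0] forces [d > 0], which is where the inequality is
     available. *)
  pose g (s : R) := expR (s - t0) * (d y s - D) + D.
  pose g' (s : R) := expR (s - t0) * (d y s - D + d' y s).
  have ss r : r \in `]t0, s[ -> t0 < r < t1.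
    by rewrite in_itv/= => /andP[-> rs]/=; exact: lt_le_trans st1.
  have isg r : r \in `]t0, s[ -> is_derive r 1 g (g' r).
    move=> /ss rs; have dyr := isd y r Sy rs.
    rewrite /g; apply: is_derive_eq.
    by rewrite /g' /GRing.scale/=; ring.
  suff : g s <= 0.
    rewrite /g => gs.
    have : expR (t0 - s) * (expR (s - t0) * (d y s - D) + D) <= 0.
      by rewrite pmulr_rle0 ?expR_gt0.
    rewrite mulrDr mulrA -expRD (_ : t0 - s + (s - t0) = 0); last by ring.
    by rewrite expR0 mul1r; nra.
  apply: (@barrier_le0 _ g t0 s t0s).
  - have cy : {within `[t0, s], continuous (d y)}.
      apply: (continuous_subspaceW _ (cd y Sy)); apply: subset_itvl.
      by rewrite bnd_simp.
    move=> r; apply: cvgD; last exact: cvg_cst.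
    apply: cvgM; last by apply: cvgB; [exact: cy|exact: cvg_cst].
    apply: (continuous_subspaceT (f := fun s => expR (s - t0))) => {}r.
    apply: (@continuous_comp _ _ _ (fun s => s - t0) expR); last first.
      exact: continuous_expR.
    by apply: continuousB; [exact: cvg_id|exact: cvg_cst].
  - by move=> r rs; have [] := isg r rs.
  - move=> r rs gr; rewrite derive1E; have [_ ->] := isg r rs.
    have dr : 0 < d y r.
      have e1 : 1 <= expR (r - t0).
        rewrite -expR0 ler_expR subr_ge0.
        by move: rs; rewrite in_itv/= => /andP[/ltW].
      move: gr; rewrite /g; have := expR_gt0 (r - t0); nra.
    have /andP[t0r rt1] := ss r rs.
    have H : d' y r <= D - d y r.
      by apply: dd' => //= [|z Sz]; [rewrite t0r|apply: dD => //; rewrite !ltW].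
    rewrite /g' pmulr_rle0 ?expR_gt0//; lra.
  - by rewrite /g subrr expR0 mul1r subrK; exact: d0.
have t01 : t0 <= t1 by case/andP: tt => /le_trans; apply.
have De : D <= D * (1 - expR (t0 - t1)).
  apply: ge_sup; first by exists 0.
  move=> r [->|[y [s [Sy st ->]]]].
    by rewrite mulr_ge0// subr_ge0 -expR0 ler_expR subr_le0.
  apply: (le_trans (key y s Sy st)); rewrite ler_wpM2l// lerB// ler_expR.
  by case/andP: st => _ st; lra.
apply: (le_trans (dD x t Sx tt)).
have := expR_gt0 (t0 - t1); nra.
Qed.

(** * Affine invariance of Lebesgue measure *)

(** An open set is the union of the countably many cubes with rational centre and half-side
    [1/(k+1)] that it contains. Each cube is a finite intersection of coordinate preimages. *)
Lemma open_measurable_rV (R : realType) (n : nat) (U : set 'rV[R]_n) :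
  open U -> measurable U.
Proof.
move=> oU.
pose B (z : 'rV[rat]_n * nat) : set 'rV[R]_n :=
  \bigcap_(i in [set: 'I_n])
    (@coord_rV R n i @^-1` ball (ratr (z.1 ord0 i) : R) z.2.+1%:R^-1).
have mB z : measurable (B z).
  apply: fin_bigcap_measurable => // i _.
  rewrite -[X in measurable X]setTI; apply: measurable_coord_rV => //.
  by apply: open_measurable; exact: ball_open.
pose I : set ('rV[rat]_n * nat) := [set z | B z `<=` U].
rewrite (_ : U = \bigcup_(z in I) B z).
  rewrite bigcup_mkcond; apply: countable_bigcupT_measurable => [|z].
    exact: countableP.
  by case: ifP.
apply/seteqP; split=> [x Ux|x [z Iz]]; last exact: Iz.
have /nbhs_ballP[e /= e0 xeU] : nbhs x U by exact: open_nbhs_nbhs.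
(* Half of [e]: two points of a cube differ by less than twice its half-side. *)
have [k ke] : exists k : nat, k.+1%:R^-1 < e / 2.
  exists (Num.truncn (e / 2)^-1).
  by rewrite invf_plt ?posrE ?divr_gt0// truncnS_gt.
have q i : exists q : rat, ball (ratr q : R) k.+1%:R^-1 (x ord0 i).
  have [] := @rat_in_itvoo R (x ord0 i - k.+1%:R^-1) (x ord0 i + k.+1%:R^-1).
    by rewrite ltrBlDr -addrA ltrDl addr_gt0.
  move=> q; rewrite in_itv/= => /andP[q1 q2]; exists q.
  by rewrite /ball/= ltr_distl q1 q2.
have [q' q'P] := choice q.
have Q y : B (\row_i q' i, k) y <->
    forall i, ball (ratr (q' i) : R) k.+1%:R^-1 (y ord0 i).
  split=> [By i|By i _]; last by rewrite /= mxE; exact: By.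
  by have := By i Logic.I; rewrite /= mxE.
exists (\row_i q' i, k); last exact/Q.
move=> y /Q Hy; apply: xeU; split=> // i j; rewrite (ord1 i).
have := q'P j; have := Hy j; rewrite /ball/= => h1 h2.
rewrite (_ : x ord0 j - y ord0 j
  = (ratr (q' j) - y ord0 j) - (ratr (q' j) - x ord0 j)); last by ring.
apply: (le_lt_trans (ler_normB _ _)); move: h1 h2 ke; set h := _^-1; lra.
Qed.

Lemma measurable_continuous_rV (R : realType) (n : nat) (f : 'rV[R]_n -> R) :
  continuous f -> measurable_fun [set: 'rV[R]_n] f.
Proof.
move=> /continuousP cf.
apply: (measurability _ (RGenOpens.measurableE R)) => _ [_ [a [b ->] <-]].
by rewrite setTI; apply: open_measurable_rV; apply: cf; exact: interval_open.
Qed.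

(** By uniqueness of Lebesgue measure, half-open intervals suffice. The map is a translation or a
    reflection; a reflection swaps the open and the closed end, which leaves the length
    unchanged. *)
Lemma lebesgue_measure_affine (R : realType) (s c : R) (A : set R) : `|s| = 1 ->
  measurable A ->
  lebesgue_measure ((fun y => s * y + c) @^-1` A) = lebesgue_measure A.
Proof.
move=> s1 mA.
have mT : measurable_fun [set: measurableTypeR R]
   ((fun y => s * y + c) : measurableTypeR R -> measurableTypeR R).
  by apply: measurable_funD => //; exact: measurable_funM.
apply/esym.
apply: (@lebesgue_measure_unique R (pushforward lebesgue_measure
  ((fun y => s * y + c) : measurableTypeR R -> measurableTypeR R))) => //.
move=> _ [[a b]] _ <-; rewrite /= /pushforward.
have := s1; case: ler0P => s0 {}s1. 
  rewrite (_ : _ @^-1` _ = `[c - b, c - a[%classic); last first.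
    apply/seteqP; split => y /=;
      rewrite !in_itv/= => /andP[? ?]; apply/andP; split; nra.
  rewrite !lebesgue_measure_itv/= !lte_fin -!EFinB.
  by rewrite ltrD2l ltrN2; case: ifP => // _; congr EFin; ring.
rewrite (_ : _ @^-1` _ = `]a - c, b - c]%classic); last first.
  apply/seteqP; split => y /=;
      rewrite !in_itv/= => /andP[? ?]; apply/andP; split; nra.
rewrite !lebesgue_measure_itv/= !lte_fin -!EFinB.
by rewrite ltrD2r; case: ifP => // _; congr EFin; ring.
Qed.

Lemma measurable_affine_rV (R : realType) (n : nat) (s : R) (c : 'rV[R]_n) :
  measurable_fun [set: 'rV[R]_n] (fun y => s *: y + c).
Proof.
apply: measurable_fun_rV => i.
rewrite (_ : _ \o _ = fun y => s * coord_rV i y + c ord0 i); last first.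
  by apply/funext => y; rewrite /coord_rV/= !mxE.
apply: measurable_funD => //; apply: measurable_funM => //.
exact: measurable_coord_rV.
Qed.

(** Induction on the dimension by slicing: the map acts coordinatewise, so the induction hypothesis
    handles each section and the one-dimensional case handles the integral over the first
    coordinate. *)
Lemma lebesgue_rV_affine (R : realType) (n : nat) (s : R) (c : 'rV[R]_n)
    (A : set 'rV[R]_n) : `|s| = 1 -> measurable A ->
  lebesgue_rV R n ((fun y => s *: y + c) @^-1` A) = lebesgue_rV R n A.
Proof.
move=> s1; elim: n c A => [|n IH] c A mA.
  congr (lebesgue_rV R 0 _); apply/seteqP.
  by split=> y /=; rewrite [_ *: _ + _](_ : _ = y)//; apply/rowP => -[].
pose c0 : R := c ord0 ord0; pose c' : 'rV[R]_n := \row_i c ord0 (lift ord0 i).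
have mA' : measurable (@cons_rV R n @^-1` A).
  by rewrite -[X in measurable X]setTI; exact: measurable_cons_rV.
rewrite /= /lebesgue_rV_step /pushforward /product_measure1 /=.
pose g (a : R) := lebesgue_rV R n (xsection (@cons_rV R n @^-1` A) a).
have mg : measurable_fun [set: measurableTypeR R] g.
  exact: measurable_fun_xsection.
transitivity (\int[@lebesgue_measure R]_a g (s * (a : R) + c0)%R)%E.
  apply: eq_integral => a _; rewrite /= /g -[RHS](IH c'); last first.
    exact: measurable_xsection.
    congr (lebesgue_rV R n _); apply/seteqP.
    have E y : s *: cons_rV (a, y) + c = cons_rV (s * a + c0, s *: y + c').
      apply/rowP => i; rewrite mxE [X in X + _]mxE.
      case: (unliftP ord0 i) => [j ->|->]; first by rewrite !cons_rVS !mxE.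
      by rewrite !cons_rV0.
    by split => y; rewrite /xsection/= !inE/= E.

pose T : measurableTypeR R -> measurableTypeR R := fun y => s * y + c0.
have mT : measurable_fun setT T.
  by apply: measurable_funD => //; exact: measurable_funM.
transitivity (\int[pushforward lebesgue_measure T]_(a in setT) g a)%E.
  by rewrite ge0_integral_pushforward.
apply: eq_measure_integral => B mB _.
exact: lebesgue_measure_affine.
Qed.

Lemma measurable_lebesgue_space (R : realType) (n : nat) (A : set 'rV[R]_n) :
  measurable A -> measurable (A : set (lebesgue_space R n)).
Proof. exact: caratheodory_measurable_mu_ext. Qed.

Lemma lebesgue_muE (R : realType) (n : nat) (A : set 'rV[R]_n) :
  measurable A -> lebesgue_mu R n A = lebesgue_rV R n A.
Proof. by move=> mA; exact: measurable_mu_extE. Qed.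

Lemma measurable_fun_lebesgue_space (R : realType) (n : nat) d
    (T : measurableType d) (f : 'rV[R]_n -> T) :
  measurable_fun [set: 'rV[R]_n] f ->
  measurable_fun [set: lebesgue_space R n] (f : lebesgue_space R n -> T).
Proof.
move=> mf _ B mB; rewrite setTI; apply: measurable_lebesgue_space.
by rewrite -[X in measurable X]setTI; exact: mf.
Qed.

(** The map goes from the Lebesgue sigma-algebra to the Borel one, where the image of the completed
    measure is [lebesgue_rV]. This avoids pulling back general Lebesgue-measurable sets. *)
Lemma ge0_integral_lebesgue_mu_affine (R : realType) (n : nat) (s : R)
    (c : 'rV[R]_n) (f : 'rV[R]_n -> \bar R) : `|s| = 1 ->
  measurable_fun [set: 'rV[R]_n] f -> (forall y, 0 <= f y)%E ->
  (\int[lebesgue_mu R n]_y f (s *: (y : 'rV[R]_n) + c)%R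
   = \int[lebesgue_rV R n]_y f y)%E.
Proof.
move=> s1 mf f0.
pose T : lebesgue_space R n -> 'rV[R]_n := fun y => s *: (y : 'rV[R]_n) + c.
have mT : measurable_fun [set: lebesgue_space R n] T.
  by apply: measurable_fun_lebesgue_space; exact: measurable_affine_rV.
transitivity (\int[pushforward (lebesgue_mu R n) T]_(y in setT) f y)%E.
  by rewrite ge0_integral_pushforward.
apply: eq_measure_integral => A mA _.
rewrite /= /pushforward lebesgue_muE; first exact: lebesgue_rV_affine.
by rewrite -[X in measurable X]setTI; exact: measurable_affine_rV.
Qed.

Lemma integral_lebesgue_mu_affine (R : realType) (n : nat) (s : R)
    (c : 'rV[R]_n) (f : 'rV[R]_n -> \bar R) : `|s| = 1 ->
  measurable_fun [set: 'rV[R]_n] f ->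
  (\int[lebesgue_mu R n]_y f (s *: (y : 'rV[R]_n) + c)%R
   = \int[lebesgue_mu R n]_y f y)%E.
Proof.
move=> s1 mf.
have key (g : 'rV[R]_n -> \bar R) : measurable_fun [set: 'rV[R]_n] g ->
    (forall y, 0 <= g y)%E ->
    (\int[lebesgue_mu R n]_y g (s *: (y : 'rV[R]_n) + c)%R
     = \int[lebesgue_mu R n]_y g y)%E.
  move=> mg g0; rewrite ge0_integral_lebesgue_mu_affine//.
  (* The identity map converts the Borel integral back to the completed one. *)
  rewrite -(@ge0_integral_lebesgue_mu_affine R n 1 0)//; last exact: normr1.
  by apply: eq_integral => y _; rewrite scale1r addr0.
pose T : lebesgue_space R n -> 'rV[R]_n := fun y => s *: (y : 'rV[R]_n) + c.
rewrite [LHS]integralE [RHS]integralE; congr (_ - _)%E.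
  by rewrite (funepos_comp f T); exact: (key _ (measurable_funepos mf)).
by rewrite (funeneg_comp f T); exact: (key _ (measurable_funeneg mf)).
Qed.

(** * The operator on quadratic test functions *)

Lemma sqr_enorm (R : realType) (n : nat) (x : 'rV[R]_n) :
  enorm x ^+ 2 = \sum_(i < n) x ord0 i ^+ 2.
Proof. by rewrite sqr_sqrtr// sumr_ge0// => i _; exact: sqr_ge0. Qed.

Lemma enorm_ge0 (R : realType) (n : nat) (x : 'rV[R]_n) : 0 <= enorm x.
Proof. exact: sqrtr_ge0. Qed.

Lemma enorm0 (R : realType) (n : nat) : enorm (0 : 'rV[R]_n) = 0.
Proof. by rewrite /enorm big1 ?sqrtr0// => i _; rewrite mxE expr0n. Qed.

Lemma enormN (R : realType) (n : nat) (x : 'rV[R]_n) : enorm (- x) = enorm x.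
Proof. by congr Num.sqrt; apply: eq_bigr => i _; rewrite mxE sqrrN. Qed.

(** Stands in for the triangle inequality: dropping one square on the left bounds the other while
    keeping to squared norms. *)
Lemma enorm_parallelogram (R : realType) (n : nat) (x y : 'rV[R]_n) :
  enorm (x + y) ^+ 2 + enorm (x - y) ^+ 2 = 2 * enorm x ^+ 2 + 2 * enorm y ^+ 2.
Proof.
rewrite !sqr_enorm !mulr_sumr -!big_split/=; apply: eq_bigr => i _.
by rewrite !mxE; ring.
Qed.

Lemma enorm_eq0 (R : realType) (n : nat) (x : 'rV[R]_n) i :
  enorm x = 0 -> x ord0 i = 0.
Proof.
move=> x0; have /eqP := sqr_enorm x; rewrite x0 expr0n/= eq_sym psumr_eq0//.
  by move=> /allP/(_ i); rewrite mem_index_enum sqrf_eq0 => /(_ isT)/eqP.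
by move=> j _; exact: sqr_ge0.
Qed.

Lemma enorm_le_norm (R : realType) (n : nat) (x : 'rV[R]_n) :
  enorm x ^+ 2 <= n%:R * `|x| ^+ 2.
Proof.
rewrite sqr_enorm -[n in n%:R]card_ord -sum1_card natr_sum mulr_suml.
apply: ler_sum => i _; rewrite mul1r -[leLHS]real_normK ?num_real//.
rewrite ler_sqr ?nnegrE//; rewrite [leRHS]/Num.Def.normr/= mx_normrE.
by apply/bigmax_geP; right => /=; exists (ord0, i).
Qed.

Lemma measurable_enorm_sqr (R : realType) (n : nat) :
  measurable_fun [set: 'rV[R]_n] (fun y => enorm y ^+ 2).
Proof.
rewrite (_ : (fun _ => _) = fun y : 'rV[R]_n => \sum_(i < n) coord_rV i y ^+ 2).
  apply: measurable_sum => i; apply: measurable_funX; exact: measurable_coord_rV.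
by apply/funext => y; rewrite sqr_enorm.
Qed.

Lemma lebesgue_mu_hyperplane (R : realType) (n : nat) :
  lebesgue_mu R n.+1 [set x : 'rV[R]_n.+1 | x ord0 ord0 = 0] = 0%E.
Proof.
rewrite (_ : [set x | _] = @coord_rV R n.+1 ord0 @^-1` [set 0])//.
have m0 : measurable (@coord_rV R n.+1 ord0 @^-1` [set 0]).
  by rewrite -[X in measurable X]setTI; apply: measurable_coord_rV.
rewrite lebesgue_muE//= /lebesgue_rV_step /pushforward.
rewrite (_ : _ @^-1` _ = [set 0] `*` setT).
  rewrite product_measure1E// [X in (X * _)%E](_ : _ = 0%E) ?mul0e//.
  exact: lebesgue_measure_set1.
apply/seteqP; split => -[a y] /=; rewrite /coord_rV/= cons_rV0//=.
by case.
Qed.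

(** The origin lies in a coordinate hyperplane, which is null. Positive dimension matters: in
    dimension 0 the measure is a Dirac mass. *)
Lemma enorm0_negligible (R : realType) (n : nat) : (0 < n)%N ->
  (lebesgue_mu R n).-negligible [set x : 'rV[R]_n | enorm x = 0].
Proof.
case: n => // n _; exists [set x : 'rV[R]_n.+1 | x ord0 ord0 = 0]; split.
- apply: measurable_lebesgue_space.
  rewrite (_ : [set x | _] = @coord_rV R n.+1 ord0 @^-1` [set 0])//.
  by rewrite -[X in measurable X]setTI; apply: measurable_coord_rV.
- exact: lebesgue_mu_hyperplane.
- by move=> x /= /enorm_eq0; apply.
Qed.

(** * The kernel, its support and its second moment *)

Record diffusion_kernel (R : realType) (n : nat) (J : 'rV[R]_n -> R) : Prop := {
  kernel_cont : continuous J ;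
  kernel_supp : compactly_supported J ;
  kernel_radial : radially_symmetric J ;
  kernel_ge0 : forall x, 0 <= J x ;
  kernel_int : (\int[lebesgue_mu R n]_x (J x)%:E = 1)%E }.

Definition second_moment (R : realType) (n : nat) (J : 'rV[R]_n -> R) : R :=
  \int[lebesgue_mu R n]_z (J z * enorm (z : 'rV[R]_n) ^+ 2).

Lemma kernel_radius (R : realType) (n : nat) (J : 'rV[R]_n -> R) :
  diffusion_kernel J ->
  exists2 rho : R, 0 < rho & forall z, J z != 0 -> enorm z ^+ 2 <= rho.
Proof.
move=> kJ; have [M [_ HM]] := compact_bounded (kernel_supp kJ).
(* The bound from compactness holds for numbers strictly above [M]; the maximum with 1 makes
   squaring monotone. *)
pose K := Num.max (M + 1) 1.
have K0 : 0 < K by rewrite lt_max ltr01 orbT.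
have KM : M < K by rewrite lt_max ltrDl ltr01.
exists (n%:R * K ^+ 2 + 1) => [|z Jz].
  by rewrite ltr_wpDl// mulr_ge0// sqr_ge0.
apply: (le_trans (enorm_le_norm z)); rewrite ler_wpDr// ler_wpM2l//.
rewrite ler_sqr ?nnegrE ?(ltW K0)//; apply: (HM K KM).
exact: subset_closure.
Qed.

Section kernel.
Context (R : realType) (n : nat) (J : 'rV[R]_n -> R).
Hypothesis kJ : diffusion_kernel J.
Local Notation mu := (lebesgue_mu R n).
Implicit Types (x y z : 'rV[R]_n) (g w : 'rV[R]_n -> R).

Lemma kernelN z : J (- z) = J z.
Proof. by apply: (kernel_radial kJ); rewrite enormN. Qed.

Lemma measurable_kernel : measurable_fun [set: 'rV[R]_n] J.
Proof. by apply: measurable_continuous_rV; exact: kernel_cont kJ. Qed.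

Lemma scaleN1rD x : (fun y => -1 *: y + x) = (fun y => x - y).
Proof. by apply/funext => y; rewrite scaleN1r addrC. Qed.

Lemma measurable_kernelB x :
  measurable_fun [set: 'rV[R]_n] (fun y => J (x - y)).
Proof.
apply: (measurableT_comp measurable_kernel).
by rewrite -scaleN1rD; exact: measurable_affine_rV.
Qed.

Lemma kernelB_int x : (\int[mu]_y (J (x - (y : 'rV[R]_n)))%:E = 1)%E.
Proof.
rewrite -(kernel_int kJ).
rewrite -(@integral_lebesgue_mu_affine R n (-1) x (EFin \o J)) ?normrN1//.
  by apply: eq_integral => y _; rewrite scaleN1r addrC.
by apply/measurable_EFinP; exact: measurable_kernel.
Qed.

(** The integrand is dominated by [C * J (x - y)]. Bounding [g] only where the kernel is nonzero
    admits unbounded quadratic functions. *)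
Lemma kernelB_integrable x g (C : R) :
  measurable_fun [set: lebesgue_space R n] (g : lebesgue_space R n -> R) ->
  (forall y, J (x - y) != 0 -> `|g y| <= C) ->
  mu.-integrable setT (fun y => (J (x - (y : 'rV[R]_n)) * g y)%:E).
Proof.
move=> mg gC.
have mJ := measurable_fun_lebesgue_space (measurable_kernelB x).
have J0 y : 0 <= J (x - y) by exact: (kernel_ge0 kJ).
apply: (@le_integrable _ (lebesgue_space R n) R mu setT measurableT _
  (fun y : lebesgue_space R n => (C * J (x - (y : 'rV[R]_n)))%:E)).
- by apply/measurable_EFinP; exact: measurable_funM.
- move=> y _; rewrite !abse_EFin lee_fin !normrM mulrC (ger0_norm (J0 _)).
  have [->|Jy] := eqVneq (J (x - y)) 0; first by rewrite !mulr0.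
  by rewrite ler_wpM2r// (le_trans (gC y Jy))// ler_norm.
- rewrite (_ : (fun _ => _) = (fun y => C%:E * (J (x - (y : 'rV[R]_n)))%:E)%E)//.
  apply: integrableZl => //; apply/integrableP.
  split; first exact/measurable_EFinP.
  rewrite (eq_integral (fun y : lebesgue_space R n =>
    (J (x - (y : 'rV[R]_n)))%:E)) ?kernelB_int ?ltry//.
  by move=> y _; rewrite gee0_abs ?lee_fin.
Qed.

Lemma kernel_integrable g (C : R) :
  measurable_fun [set: lebesgue_space R n] (g : lebesgue_space R n -> R) ->
  (forall y, J y != 0 -> `|g y| <= C) ->
  mu.-integrable setT (fun y => (J y * g y)%:E).
Proof.
move=> mg gC; rewrite (_ : (fun _ => _) =
    fun y => (J (0 - (y : 'rV[R]_n)) * g y)%:E); last first.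
  by apply/funext => y; rewrite sub0r kernelN.
by apply: (@kernelB_integrable _ _ C) => // y; rewrite sub0r kernelN; exact: gC.
Qed.

Lemma Rintegral_affine (s : R) x g : `|s| = 1 ->
  measurable_fun [set: 'rV[R]_n] g ->
  \int[mu]_y g (s *: (y : 'rV[R]_n) + x) = \int[mu]_y g y.
Proof.
move=> s1 mg; rewrite /Rintegral; congr fine.
apply: (@integral_lebesgue_mu_affine R n s x (EFin \o g)) => //.
exact/measurable_EFinP.
Qed.

(** The constant is twice the inner product. Its being common to both signs makes the cross terms
    cancel in a sum. *)
Lemma enorm_sqr_cross x z : exists c, forall s : bool,
  enorm (x + (-1) ^+ s *: z) ^+ 2 = enorm x ^+ 2 + enorm z ^+ 2 + (-1) ^+ s * c.
Proof.
exists (2 * \sum_(i < n) x ord0 i * z ord0 i) => s.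
rewrite !sqr_enorm !mulr_sumr -!big_split/=; apply: eq_bigr => i _.
by rewrite !mxE; case: s; rewrite /= ?expr0 ?expr1; ring.
Qed.

(** Test function for increments [w y - w x]: affine in the squared norm of [y], with value [al] at
    [y = x]. *)
Definition quad (al be : R) x y := al + be * (enorm y ^+ 2 - enorm x ^+ 2).

Lemma measurable_quad al be x : measurable_fun [set: 'rV[R]_n] (quad al be x).
Proof.
apply: measurable_funD => //; apply: measurable_funM => //.
by apply: measurable_funB => //; exact: measurable_enorm_sqr.
Qed.

Lemma quad_bound al be x : exists C : R,
  forall y, J (x - y) != 0 -> `|quad al be x y| <= C.
Proof.
have [rho rho0 Jrho] := kernel_radius kJ.
exists (`|al| + `|be| * (3 * enorm x ^+ 2 + 2 * rho)) => y /Jrho yrho.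
apply: (le_trans (ler_normD _ _)); rewrite lerD2l normrM ler_wpM2l//.
have := enorm_parallelogram x (x - y).
rewrite opprB addrC [x + (y - x)]addrC subrK.
have := sqr_ge0 (enorm x); have := sqr_ge0 (enorm y).
have := sqr_ge0 (enorm (x + (x - y))).
by rewrite ler_norml => *; apply/andP; split; lra.
Qed.

Lemma kernel_quad_integrable al be x :
  mu.-integrable setT (fun y => (J (x - (y : 'rV[R]_n)) * quad al be x y)%:E).
Proof.
have [C HC] := quad_bound al be x; apply: (@kernelB_integrable _ _ C) => //.
by apply: measurable_fun_lebesgue_space; exact: measurable_quad.
Qed.

Lemma second_moment_integrable :
  mu.-integrable setT (fun z => (J z * enorm (z : 'rV[R]_n) ^+ 2)%:E).
Proof.
have [rho rho0 Jrho] := kernel_radius kJ; apply: (@kernel_integrable _ rho).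
  by apply: measurable_fun_lebesgue_space; exact: measurable_enorm_sqr.
by move=> y /Jrho yrho; rewrite ger0_norm ?sqr_ge0.
Qed.

(* Averaging the substitutions [y = x - z] and [y = x + z] kills the first
   moment of [J]. *)
Lemma kernel_quad al be x :
  \int[mu]_y (J (x - (y : 'rV[R]_n)) * quad al be x y)
    = al + be * second_moment J.
Proof.
have Jq : measurable_fun [set: 'rV[R]_n] (fun y => J (x - y) * quad al be x y).
  by apply: measurable_funM; [exact: measurable_kernelB|exact: measurable_quad].
pose h (s : bool) z := J z * quad al be x (x + (-1) ^+ s *: z).
have hE (s : bool) y : J (x - ((-1) ^+ s *: y + x))
     * quad al be x ((-1) ^+ s *: y + x) = h s y.
  rewrite opprD addrCA subrr addr0 kernelN /h (addrC x); congr (_ * _).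
  by case: s; rewrite ?expr0 ?expr1 ?scale1r ?scaleN1r ?kernelN.
have hI (s : bool) : \int[mu]_y (J (x - (y : 'rV[R]_n)) * quad al be x y)
    = \int[mu]_y h s y.
  rewrite -(@Rintegral_affine ((-1) ^+ s) x
    (fun y => J (x - y) * quad al be x y)) ?normr_sign//.
  by apply: eq_Rintegral => y _; exact: hE.
have ih (s : bool) : mu.-integrable setT (EFin \o h s).
  have [C HC] := quad_bound al be x.
  apply: (@kernel_integrable (fun z => quad al be x (x + (-1) ^+ s *: z)) C).
    apply: measurable_fun_lebesgue_space.
    apply: (measurableT_comp (measurable_quad al be x)).
    rewrite (_ : (fun z => _) = fun z => (-1) ^+ s *: z + x); last first.
      by apply/funext => z; rewrite addrC.
    exact: measurable_affine_rV.
  move=> z Jz; apply: HC; rewrite opprD addrA subrr sub0r kernelN.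
  by case: (s); rewrite ?expr0 ?expr1 ?scale1r ?scaleN1r ?kernelN.
(* Twice the integral is the sum of its two substituted forms, whose cross terms cancel
   pointwise. *)
apply: (@mulfI _ 2); first by rewrite pnatr_eq0.
rewrite mulrDl !mul1r {1}(hI false) (hI true) -RintegralD//.
have i1 : mu.-integrable setT (EFin \o J).
  rewrite (_ : EFin \o J = fun z => (J z * 1)%:E); last first.
    by apply/funext => z; rewrite /= mulr1.
  by apply: (@kernel_integrable (fun=> 1) 1) => // y _; rewrite normr1.
have i2 := second_moment_integrable.
transitivity (\int[mu]_z (2 * al * J z
                         + 2 * be * (J z * enorm (z : 'rV[R]_n) ^+ 2))).
  apply: eq_Rintegral => z _; rewrite /h /quad.
  by have [c cE] := enorm_sqr_cross x z; rewrite !cE expr0 expr1; ring.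
rewrite RintegralD//; last 2 first.
- exact: (integrableZl measurableT (2 * al) i1).
- exact: (integrableZl measurableT (2 * be) i2).
rewrite !RintegralZl// /second_moment [X in _ * al * X](_ : _ = 1).
  by ring.
by rewrite /Rintegral (kernel_int kJ).
Qed.

(** If the moment vanished, [J] would be zero almost everywhere off the origin. The origin is null,
    so this contradicts total mass 1. *)
Lemma second_moment_gt0 : (0 < n)%N -> 0 < second_moment J.
Proof.
move=> n0; rewrite lt_neqAle; apply/andP; split; last first.
  by apply: Rintegral_ge0 => z _; rewrite mulr_ge0 ?sqr_ge0// (kernel_ge0 kJ).
apply/eqP => m0.
have mJ := measurable_fun_lebesgue_space measurable_kernel.
have mJ2 : measurable_fun [set: lebesgue_space R n]
    (fun z => (J z * enorm (z : 'rV[R]_n) ^+ 2)%:E).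
  apply/measurable_EFinP; apply: measurable_funM => //.
  by apply: measurable_fun_lebesgue_space; exact: measurable_enorm_sqr.
have : (\int[mu]_z `|(J z * enorm (z : 'rV[R]_n) ^+ 2)%:E| = 0)%E.
  rewrite (eq_integral (fun z : lebesgue_space R n =>
    (J z * enorm (z : 'rV[R]_n) ^+ 2)%:E)).
    rewrite -[LHS]fineK; last exact/integrable_fin_num/second_moment_integrable.
    by congr EFin; rewrite [RHS]m0.
  by move=> z _; rewrite gee0_abs// lee_fin mulr_ge0 ?sqr_ge0// (kernel_ge0 kJ).
move/(ae_eq_integral_abs _ measurableT mJ2) => ae0.
have : (\int[mu]_z (J z)%:E = \int[mu]_z (cst 0 z))%E.
  apply: ae_eq_integral => //; first exact/measurable_EFinP.
  have nz0 : {ae mu, forall z : lebesgue_space R n, enorm (z : 'rV[R]_n) <> 0}.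
    by apply: negligibleS (enorm0_negligible R n0) => z /= /contrapT.
  apply: filterS2 ae0 nz0 => z /= + z0 _ => /(_ Logic.I)[] /eqP.
  by rewrite mulf_eq0 sqrf_eq0 => /orP[/eqP ->|/eqP].
by rewrite (kernel_int kJ) integral0 => /eqP; rewrite onee_eq0.
Qed.

(** The minorant is required only within the reach of the kernel, which permits comparison on a
    bounded ball. The global bound [M] serves integrability. *)
Lemma nonlocal_ge w (M al be : R) x :
  measurable_fun [set: lebesgue_space R n] (w : lebesgue_space R n -> R) ->
  (forall y, `|w y| <= M) ->
  (forall y, J (x - y) != 0 ->
     al + be * (enorm y ^+ 2 - enorm x ^+ 2) <= w y - w x) ->
  al + be * second_moment J <= nonlocal J w x.
Proof.
move=> mw wM wge; rewrite -(kernel_quad al be x); apply: le_Rintegral => //.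
- exact: kernel_quad_integrable.
- apply: (@kernelB_integrable x (fun y => w y - w x) (M + M)).
    exact: measurable_funB.
  by move=> y _; rewrite (le_trans (ler_normB _ _))// lerD.
- move=> y _; have [->|Jy] := eqVneq (J (x - y)) 0; first by rewrite !mul0r.
  by rewrite ler_wpM2l ?(kernel_ge0 kJ)// wge.
Qed.

Lemma nonlocal_le w (M al : R) x :
  measurable_fun [set: lebesgue_space R n] (w : lebesgue_space R n -> R) ->
  (forall y, `|w y| <= M) -> (forall y, w y - w x <= al) ->
  nonlocal J w x <= al.
Proof.
move=> mw wM wle.
rewrite (_ : al = al + 0 * second_moment J); last by rewrite mul0r addr0.
rewrite -(kernel_quad al 0 x); apply: le_Rintegral => //.
- apply: (@kernelB_integrable x (fun y => w y - w x) (M + M)).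
    exact: measurable_funB.
  by move=> y _; rewrite (le_trans (ler_normB _ _))// lerD.
- exact: kernel_quad_integrable.
- by move=> y _; rewrite ler_wpM2l ?(kernel_ge0 kJ)// /quad mul0r addr0.
Qed.

End kernel.

(** * Barriers for the nonlocal equation *)

Lemma half_line_cvg (R : realType) (f : R -> R) (t l : R) : 0 <= t ->
  (f s - f t) / (s - t) @[s --> within `[0, +oo[ t^'] --> l ->
  forall e : R, 0 < e -> exists2 r : R, 0 < r &
    forall s, 0 <= s -> s != t -> `|s - t| < r ->
      `|l - (f s - f t) / (s - t)| <= e.
Proof.
move=> t0 fl e e0; have /cvgrPdist_le/(_ e e0) := fl.
rewrite /within/= /dnbhs/= /within/= => /nbhs_ballP[r /= r0 rH]; exists r => //.
by move=> s s0 st str; apply: rH => //=; rewrite /ball/= ?in_itv/= ?s0// distrC.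
Qed.

(** Near [t] the difference quotient is within 1 of [g t], so increments from [t] are at most
    [|g t| + 1] times the time step. This covers [t = 0], where the quotient is one-sided. *)
Lemma C1_half_line_continuous (R : realType) (f : R -> R) (a b : R) :
  C1_half_line f -> 0 <= a -> {within `[a, b], continuous f}.
Proof.
move=> [g [_ fg]] a0; apply/subspace_continuousP => t /=.
rewrite in_itv/= => /andP[at_ tb]; have t0 : 0 <= t by exact: le_trans at_.
have [r r0 rH] := half_line_cvg t0 (fg t t0) ltr01.
apply/cvgrPdist_lt => e e0; pose L := `|g t| + 1.
have L0 : 0 < L by rewrite ltr_wpDl.
rewrite /within/=; apply/nbhs_ballP; exists (Num.min r (e / L)) => /=.
  by rewrite lt_min r0 divr_gt0.
move=> s; rewrite /ball/= lt_min in_itv/= => /andP[sr se] /andP[as_ _].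
have [->|st] := eqVneq s t; first by rewrite subrr normr0.
have := rH s (le_trans a0 as_) st; rewrite distrC => /(_ sr) H.
rewrite distrC (_ : f s - f t = ((f s - f t) / (s - t)) * (s - t)); last first.
  by rewrite divfK// subr_eq0.
have H2 : `|(f s - f t) / (s - t)| <= L.
  rewrite -[X in `|X|](subrK (g t)) (le_trans (ler_normD _ _))//.
  by rewrite /L addrC lerD2l distrC.
rewrite normrM (le_lt_trans (ler_wpM2r _ H2))// mulrC distrC.
by rewrite -ltr_pdivlMr.
Qed.

Lemma C1_half_line_derivable (R : realType) (f : R -> R) (t : R) :
  C1_half_line f -> 0 < t -> derivable f t 1.
Proof.
move=> [g [_ fg]] t0; apply/cvg_ex; exists (g t) => /=.
apply/cvgrPdist_le => e e0.
have [r r0 rH] := half_line_cvg (ltW t0) (fg t (ltW t0)) e0.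
(* A radius of at most [t] keeps [t + h] in the half-line. *)
rewrite /dnbhs/= /within/=; apply/nbhs_ballP; exists (Num.min r t) => /=.
  by rewrite lt_min r0.
move=> h; rewrite /ball/= sub0r normrN lt_min => /andP[hr ht] h0.
have := rH (h *: 1 + t); rewrite addrK /GRing.scale/= mulr1 mulrC; apply.
- by move: ht; rewrite ltr_norml => /andP[? _]; lra.
- by rewrite -subr_eq0 addrK.
- by [].
Qed.

(** Tangent-line inequality. Scaling by [A] reduces it to the tangent at 1, where [s^(-q) = exp (- q
    ln s) >= 1 - q ln s >= 1 - q (s - 1)]. *)
Lemma powRN_convex (R : realType) (q A B : R) : 0 < q -> 0 < A -> 0 < B ->
  - q * A `^ (- q - 1) * (B - A) <= B `^ (- q) - A `^ (- q).
Proof.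
move=> q0 A0 B0; pose s := B / A; have s0 : 0 < s by rewrite divr_gt0.
have BE : B = s * A by rewrite divfK// gt_eqF.
have ss : 1 - q * (s - 1) <= s `^ (- q).
  rewrite /powR gt_eqF//; apply: le_trans (expR_ge1Dx _).
  rewrite lerD2l mulNr lerN2 ler_wpM2l ?(ltW q0)//.
  by have := @le_ln1Dx R (s - 1); rewrite (addrC 1) subrK; apply; lra.
have AE : A `^ (- q) = A `^ (- q - 1) * A.
  by rewrite -[X in _ * X](powRr1 (ltW A0)) -powRD ?subrK// (gt_eqF A0) implybT.
rewrite BE powRM ?(ltW s0) ?(ltW A0)//.
have := powR_gt0 (- q - 1) A0; move: ss AE; set a := A `^ (- q - 1).
move=> ss -> a0; have := mulr_gt0 a0 A0; nra.
Qed.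

Lemma is_derive_powRN_affine (R : realType) (q a b T t : R) :
  0 < a + b * (t - T) ->
  is_derive t 1 (fun t => (a + b * (t - T)) `^ (- q))
    (- q * b * (a + b * (t - T)) `^ (- q - 1)).
Proof.
move=> at0.
have h : is_derive t 1 (fun t => a + b * (t - T)) b.
  by apply: is_derive_eq; rewrite /GRing.scale/=; ring.
have H := @is_derive1_comp R (fun x => x `^ (- q))
  (fun t => a + b * (t - T)) t _ _ (@is_derive1_powR R (- q) _ at0) h.
rewrite (_ : - q * b * _ = - q * (a + b * (t - T)) `^ (- q - 1) * b).
  exact: H.
by ring.
Qed.

Lemma powRN_le (R : realType) (q A B : R) : 0 <= q -> 0 < A -> A <= B ->
  B `^ (- q) <= A `^ (- q).
Proof.
move=> q0 A0 AB; rewrite !powRN lef_pV2 ?posrE ?powR_gt0//; last first.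
  exact: lt_le_trans AB.
by apply: ge0_ler_powR => //; rewrite nnegrE ltW// (lt_le_trans A0).
Qed.

Lemma is_derive_within_continuous (R : realType) (v v' : R -> R) (a b : R) :
  (forall t, a <= t <= b -> is_derive t 1 v (v' t)) ->
  {within `[a, b], continuous v}.
Proof.
move=> dv; apply: derivable_within_continuous => t.
by rewrite in_itv/= => /dv[].
Qed.

(** * Bounds for the solution by explicit barriers *)

Section solution.
Context (R : realType) (n : nat) (p : R) (J u0 : 'rV[R]_n -> R)
  (u : 'rV[R]_n -> R -> R).
Hypothesis p1 : 1 < p.
Hypothesis kJ : diffusion_kernel J.
Hypothesis hu : bounded_solution p J u0 u.
Local Notation q := (1 / (p - 1)).
Local Notation m := (second_moment J).

Let q0 : 0 < q. Proof. by rewrite divr_gt0// subr_gt0. Qed.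

Let qp : q * (p - 1) = 1. Proof. by rewrite divfK// gt_eqF// subr_gt0. Qed.

Lemma solution_section_measurable (t : R) : 0 <= t ->
  measurable_fun [set: lebesgue_space R n] (u ^~ t : lebesgue_space R n -> R).
Proof.
move=> t0.
apply: (@measurable_comp _ _ _ _ _ _
  ([set: lebesgue_space R n] `*` (`[0, +oo[ : set R))
  (fun z : lebesgue_space R n * R => u z.1 z.2) setT
  (fun x : lebesgue_space R n => (x, t))).
- by apply: measurableX => //; exact: measurable_itv.
- by move=> _ [x _ <-]; split => //=; rewrite in_itv/= t0.
- exact: solution_measurable hu.
- exact: pair2_measurable.
Qed.

Lemma solution_derive x (t : R) : 0 < t ->
  is_derive t 1 (u x) (nonlocal J (u ^~ t) x - u x t `^ p).
Proof.
move=> t0; rewrite -(solution_eq hu)// derive1E; apply: derivableP.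
exact: C1_half_line_derivable (solution_C1 hu x) t0.
Qed.

Lemma solution_continuous x (a b : R) : 0 <= a -> {within `[a, b], continuous (u x)}.
Proof. by move=> a0; exact: C1_half_line_continuous (solution_C1 hu x) a0. Qed.

(** From [q p = q + 1]; hence [A^(-q)] solves [v' = - v^p] when [A] grows at speed [p - 1]. *)
Let powE (A : R) : 0 < A -> (A `^ (- q)) `^ p = A `^ (- q - 1).
Proof.
move=> A0; rewrite -powRrM; congr (_ `^ _).
have := qp; nra.
Qed.

Lemma subsolution_le (c eps T : R) : 0 <= T -> 0 <= eps -> 0 < c -> 0 <= m ->
  (forall x, (c + eps * enorm x ^+ 2) `^ (- q) <= u x T) ->
  forall x t, T <= t ->
    (c + eps * enorm x ^+ 2 + (p - 1 + eps * m) * (t - T)) `^ (- q) <= u x t.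
Proof.
move=> T0 e0 c0 m0 init x t Tt.
pose a (y : 'rV[R]_n) s : R :=
  c + eps * enorm y ^+ 2 + (p - 1 + eps * m) * (s - T).
have ac y s : T <= s -> c <= a y s.
  move=> Ts; rewrite /a -addrA lerDl addr_ge0// mulr_ge0 ?sqr_ge0//.
    by rewrite addr_ge0 ?mulr_ge0// subr_ge0 ltW.
  by rewrite subr_ge0.
have a0 y s : T <= s -> 0 < a y s by move=> /(ac y); exact: lt_le_trans.
pose v y s := a y s `^ (- q).
pose v' y s := - q * (p - 1 + eps * m) * a y s `^ (- q - 1).
have dv y s : T <= s -> is_derive s 1 (v y) (v' y s).
  by move=> Ts; apply: is_derive_powRN_affine; exact: a0.
have [M uM] := solution_bounded hu.
rewrite -subr_le0 -/(v x t).
apply: (@comparison_principle R _ (fun=> True) T t (fun y s => v y s - u y s)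
  (fun y s => v' y s - (nonlocal J (u ^~ s) y - u y s `^ p))) => //.
- exists (c `^ (- q)) => y s _ /andP[Ts _].
  rewrite lerBlDr ler_wpDr//; first by rewrite (solution_ge0 hu)// (le_trans T0).
  by apply: powRN_le => //; [exact: ltW|exact: ac].
- move=> y _ s; apply: cvgB; last exact: solution_continuous.
  apply: (is_derive_within_continuous (v' := v' y)) => {}s /andP[Ts _].
  exact: dv.
- move=> y s _ /andP[Ts _]; apply: is_deriveB; first exact/dv/ltW.
  by apply: solution_derive; exact: le_lt_trans Ts.
- move=> y s D _ /andP[Ts st] d0 dD.
  have s0 : 0 < s by exact: le_lt_trans Ts.
  pose b := a y s `^ (- q - 1).
  have b0 : 0 < b by rewrite powR_gt0// a0// ltW.
  (* Where [v > u], the absorption of [u] is at most that of [v], which equals [b]. *)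
  have upv : u y s `^ p <= b.
    rewrite /b -powE; last by rewrite a0// ltW.
    apply: ge0_ler_powR.
    + by rewrite (le_trans ler01)// ltW.
    + by rewrite nnegrE (solution_ge0 hu)// ltW.
    + by rewrite nnegrE powR_ge0.
    + by move: d0; rewrite subr_gt0 => /ltW.
  (* Replace [u z] by its lower bound [v z - D], then bound [v z - v y] below by the tangent at
     [a y s]; the result is affine in the squared norm of [z]. *)
  have : v y s - u y s - D + (- q * b * eps) * m <= nonlocal J (u ^~ s) y.
    apply: (nonlocal_ge kJ (M := M)).
    + by apply: solution_section_measurable; exact: ltW.
    + by move=> z; apply: uM; exact: ltW.
    + move=> z _; have := dD z Logic.I.
      have := powRN_convex q0 (a0 y s (ltW Ts)) (a0 z s (ltW Ts)).
      rewrite -/b -/(v z s) -/(v y s).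
      rewrite (_ : a z s - a y s = eps * (enorm z ^+ 2 - enorm y ^+ 2)); last first.
        by rewrite /a; ring.
      lra.
  rewrite /v' -/b.
  (* The speed of [a] splits: [p - 1] pays for the absorption [b], and [eps * m] for the diffusion
     term. *)
  have -> : - q * (p - 1 + eps * m) * b
      = - (q * (p - 1)) * b + (- q * b * eps) * m.
    by ring.
  rewrite qp; lra.
- move=> y _; rewrite subr_le0 /v /a subrr mulr0 addr0; exact: init.
- by rewrite Tt lexx.
Qed.

Lemma supersolution_ge (c : R) : 0 < c -> (forall x, u0 x <= c `^ (- q)) ->
  forall x (t : R), 0 <= t -> u x t <= (c + (p - 1) * t) `^ (- q).
Proof.
move=> c0 init x t t0.
(* The [- 0] gives the form of [is_derive_powRN_affine] with starting time 0. *)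
pose a s : R := c + (p - 1) * (s - 0).
have p0 : 0 < p - 1 by rewrite subr_gt0.
have a0 (s : R) : 0 <= s -> 0 < a s.
  by move=> s0; rewrite /a subr0 ltr_pwDl// mulr_ge0// ltW.
pose v s := a s `^ (- q).
pose v' s := - q * (p - 1) * a s `^ (- q - 1).
have dv (s : R) : 0 <= s -> is_derive s 1 v (v' s).
  by move=> s0; apply: is_derive_powRN_affine; exact: a0.
have [M uM] := solution_bounded hu.
rewrite -subr_le0 (_ : c + _ = a t); last by rewrite /a subr0.
rewrite -/(v t).
apply: (@comparison_principle R _ (fun=> True) 0 t (fun y s => u y s - v s)
  (fun y s => (nonlocal J (u ^~ s) y - u y s `^ p) - v' s)) => //.
- exists M => y s _ /andP[s0 _]; rewrite lerBlDr ler_wpDr ?powR_ge0//.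
  by rewrite (le_trans (ler_norm _))// uM.
- move=> y _ s; apply: cvgB; first exact: solution_continuous.
  apply: (is_derive_within_continuous (v' := v')) => {}s /andP[s0 _].
  exact: dv.
- move=> y s _ /andP[s0 _]; apply: is_deriveB; first exact: solution_derive.
  exact/dv/ltW.
- move=> y s D _ /andP[s0 _] d0 dD.
  have vpu : a s `^ (- q - 1) <= u y s `^ p.
    rewrite -powE; last by rewrite a0// ltW.
    apply: ge0_ler_powR.
    + by rewrite (le_trans ler01)// ltW.
    + by rewrite nnegrE powR_ge0.
    + by rewrite nnegrE (solution_ge0 hu)// ltW.
    + by move: d0; rewrite subr_gt0 => /ltW.
  (* The barrier is constant in space, so [u z - u y] is a difference of values of [u - v]. *)
  have : nonlocal J (u ^~ s) y <= D - (u y s - v s).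
    apply: (nonlocal_le kJ (M := M)).
    + by apply: solution_section_measurable; exact: ltW.
    + by move=> z; apply: uM; exact: ltW.
    + move=> z; have := dD z Logic.I; lra.
  rewrite /v' mulNr qp; lra.
- move=> y _; rewrite subr_le0 /v /a (solution_init hu) subrr mulr0 addr0.
  exact: init.
- by rewrite t0 lexx.
Qed.

Let absorption_le (M : R) : (forall x (t : R), 0 <= t -> `|u x t| <= M) ->
  forall x t, 0 <= t -> u x t `^ p <= M `^ (p - 1) * u x t.
Proof.
move=> uM x t t0; have ut0 := solution_ge0 hu x t0.
rewrite -mulr_powRB1//; last by rewrite (lt_trans ltr01).
rewrite mulrC ler_wpM2r// ge0_ler_powR//.
- by rewrite subr_ge0 ltW.
- by rewrite nnegrE (le_trans (normr_ge0 _) (uM x t t0)).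
- exact: le_trans (ler_norm _) (uM x t t0).
Qed.

(** As [u >= 0] and [J] has mass 1, [L u >= - u]; the absorption is at most [M^(p-1) u]. Hence
    [u_t >= - K u] with [K = 1 + M^(p-1)]. The linear bound on the absorption is exported because
    [solution_positive] needs it with the same [K]. *)
Lemma solution_ge_expR : exists2 K : R, 0 <= K & forall x (t : R), 0 <= t ->
  expR (- K * t) * u0 x <= u x t /\
  (0 < t -> u x t `^ p <= K * u x t).
Proof.
have [M uM] := solution_bounded hu.
pose K := 1 + M `^ (p - 1).
have K1 : 1 <= K by rewrite lerDl powR_ge0.
have upK := absorption_le uM.
exists K; first exact: le_trans K1.
move=> x t t0; split; last first.
  move=> t1; rewrite (le_trans (upK x t t0))//.
  by rewrite ler_wpM2r ?(solution_ge0 hu)// lerDr.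
pose v y s := expR (- K * s) * u0 y.
have dv y (s : R) : is_derive s 1 (v y) (- K * v y s).
  by apply: is_derive_eq; rewrite /v /GRing.scale/=; ring.
have u00 y : 0 <= u0 y by rewrite -(solution_init hu) (solution_ge0 hu).
have v0 y s : 0 <= v y s by rewrite mulr_ge0// expR_ge0.
rewrite -subr_le0 -/(v x t).
apply: (@comparison_principle R _ (fun=> True) 0 t (fun y s => v y s - u y s)
  (fun y s => - K * v y s - (nonlocal J (u ^~ s) y - u y s `^ p))).
- exists M => y s _ /andP[s0 _]; rewrite lerBlDr ler_wpDr ?(solution_ge0 hu)//.
  apply: (@le_trans _ _ (u0 y)).
    rewrite ler_piMl// -expR0 ler_expR mulNr oppr_le0 mulr_ge0//.
    exact: le_trans K1.
  by rewrite -(solution_init hu) (le_trans (ler_norm _))// uM.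
- move=> y _ s; apply: cvgB; last exact: solution_continuous.
  by apply: (is_derive_within_continuous (v' := fun s => - K * v y s)) => {}s _.
- by move=> y s _ /andP[s0 _]; apply: is_deriveB => //; exact: solution_derive.
- move=> y s D _ /andP[s0 _] d0 dD.
  have : - u y s + 0 * second_moment J <= nonlocal J (u ^~ s) y.
    apply: (nonlocal_ge kJ (M := M)).
    + by apply: solution_section_measurable; exact: ltW.
    + by move=> z; apply: uM; exact: ltW.
    + move=> z _; have := solution_ge0 hu z (ltW s0); lra.
  have Kd : 0 <= K * (v y s - u y s) by rewrite mulr_ge0 ?(le_trans _ K1) ?ltW.
  have := upK y s (ltW s0); have := dD y Logic.I; move: Kd; rewrite mul0r.
  rewrite (_ : M `^ (p - 1) = K - 1); [lra|by rewrite /K; ring].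
- by move=> y _; rewrite /v mulr0 expR0 mul1r (solution_init hu) subrr.
- by [].
- by rewrite t0 lexx.
Qed.

(* The quadratic [|x|^2 - r2] is nonpositive on the ball where [u0] may vanish,
   and the linear flow lifts it at speed [m], so it turns positive there. *)
Lemma solution_positive (r2 : R) : 0 <= r2 -> 0 < m ->
  (forall R2, exists2 c, 0 < c &
     forall x, r2 < enorm x ^+ 2 <= R2 -> c <= u0 x) ->
  exists2 dlt, 0 < dlt & forall x, enorm x ^+ 2 <= r2 ->
    dlt <= u x ((r2 + 1) / m).
Proof.
move=> r20 m0 shell.
have [rho rho0 Jrho] := kernel_radius kJ.
have [K K0 uK] := solution_ge_expR.
have [M uM] := solution_bounded hu.
(* By the parallelogram identity, the kernel centred in the ball [|y|^2 <= r2] reaches only points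
   with [|z|^2 <= R2]. *)
pose R2 := 2 * r2 + 2 * rho.
have [c c0 cu0] := shell R2.
(* At this time [|x|^2 - r2 + m T >= 1] for every [x]. *)
pose T := (r2 + 1) / m.
have T0 : 0 < T by rewrite divr_gt0// ltr_wpDl.
have mT : m * T = r2 + 1 by rewrite mulrC divfK// gt_eqF.
have R2T : 0 < R2 + m * T by rewrite mT /R2; nra.
(* Scaled so that on the shell, up to time [T], the barrier stays below [expR (- K * s) * c], hence
   below [u]. *)
pose kap := c / (R2 + m * T).
have kap0 : 0 < kap by rewrite divr_gt0.
pose b s : R := expR (- K * s) * kap.
have b0 s : 0 < b s by rewrite mulr_gt0// expR_gt0.
exists (b T) => // x xr2; rewrite -/T.
pose v (y : 'rV[R]_n) s := b s * (enorm y ^+ 2 - r2 + m * s).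
have vT : b T <= v x T.
  rewrite /v mT ler_peMr ?(ltW (b0 T))//.
  have := sqr_ge0 (enorm x); lra.
apply: (le_trans vT); rewrite -subr_le0.
pose v' y s := - K * v y s + b s * m.
have dv y (s : R) : is_derive s 1 (v y) (v' y s).
  by rewrite /v /b; apply: is_derive_eq; rewrite /v' /v /b /GRing.scale/=; ring.
have vout y s : 0 <= s <= T -> r2 < enorm y ^+ 2 <= R2 -> v y s <= u y s.
  move=> /andP[s0 sT] yr; have [uy _] := uK y s s0; apply: le_trans uy.
  rewrite /v /b -mulrA ler_wpM2l ?expR_ge0//; apply: le_trans (cu0 y yr).
  rewrite [leRHS](_ : c = kap * (R2 + m * T)); last first.
    by rewrite /kap divfK// gt_eqF.
  rewrite ler_wpM2l ?(ltW kap0)//.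
  have := ler_wpM2l (ltW m0) sT; case/andP: yr => _; lra.
have R20 : r2 <= R2 by rewrite /R2; lra.
apply: (@comparison_principle R _ (fun y => enorm y ^+ 2 <= R2) 0 T
  (fun y s => v y s - u y s)
  (fun y s => v' y s - (nonlocal J (u ^~ s) y - u y s `^ p))).
- exists (kap * (R2 + m * T)) => y s yR /andP[s0 sT].
  rewrite lerBlDr ler_wpDr ?(solution_ge0 hu)//.
  have bk : b s <= kap.
    by rewrite /b ler_piMl ?(ltW kap0)// -expR0 ler_expR mulNr oppr_le0 mulr_ge0.
  apply: (@le_trans _ _ (b s * (R2 + m * T))).
    rewrite /v ler_wpM2l ?(ltW (b0 s))//.
    have := ler_wpM2l (ltW m0) sT; lra.
  by rewrite ler_wpM2r// ltW.
- move=> y _ s; apply: cvgB; last exact: solution_continuous.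
  by apply: (is_derive_within_continuous (v' := v' y)) => {}s _; exact: dv.
- by move=> y s _ /andP[s0 _]; apply: is_deriveB => //; exact: solution_derive.
- move=> y s D yR /andP[s0 sT] d0 dD.
  (* By [vout] a positive difference occurs only in the inner ball, whose kernel neighbourhood stays
     in the domain where [D] is a bound. *)
  have yr2 : enorm y ^+ 2 <= r2.
    rewrite leNgt; apply/negP => yr2; move: d0; rewrite subr_gt0 ltNge.
    by rewrite vout// ?yr2// !ltW.
  have : v y s - u y s - D + b s * m <= nonlocal J (u ^~ s) y.
    apply: (nonlocal_ge kJ (M := M)).
    + by apply: solution_section_measurable; exact: ltW.
    + by move=> z; apply: uM; exact: ltW.
    + move=> z /Jrho zrho; have : v z s - u z s <= D.
        apply: dD; have := enorm_parallelogram y (y - z).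
        rewrite opprB addrC [y + (z - y)]addrC subrK.
        have := sqr_ge0 (enorm (y + (y - z))); rewrite /R2; lra.
      rewrite /v; lra.
  have [_ /(_ s0)] := uK y s (ltW s0).
  (* The growth [b s * m] of the barrier cancels against diffusion, and its damping [- K * v]
     outweighs the absorption because [v > u]. *)
  have Kd : 0 <= K * (v y s - u y s) by rewrite mulr_ge0// ltW.
  have := dD y yR; move: Kd; rewrite /v'; lra.
- move=> y yR; have [yr2|yr2] := leP (enorm y ^+ 2) r2; last first.
    by rewrite subr_le0 vout ?lexx ?(ltW T0)// yr2.
  rewrite subr_le0 (le_trans _ (solution_ge0 hu y (lexx 0)))//.
  by rewrite /v mulr0 addr0 pmulr_rle0// subr_le0.
- exact: le_trans xr2 R20.
- by rewrite ltW// lexx.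
Qed.

(** At time [T] the initial profile is compared on three zones: the ball, where [solution_positive]
    applies; a shell, where the decay hypothesis with constant 1 gives a lower bound; and the
    exterior, where decay beats [eps |x|^2]. Only the outer radius and [c] depend on [eps]. *)
Lemma solution_lower_profile : 0 < m ->
  (forall A : R, exists r : R, forall x, r < enorm x ->
     A < enorm x `^ (2 / (p - 1)) * u0 x) ->
  exists2 T : R, 0 <= T & forall eps : R, 0 < eps -> exists2 c : R, 0 < c &
    forall x (t : R), T <= t ->
      (c + eps * enorm x ^+ 2 + (p - 1 + eps * m) * (t - T)) `^ (- q) <= u x t.
Proof.
move=> m0 decay.
have p0 : 0 < p - 1 by rewrite subr_gt0.
have decay' (A : R) : 0 <= A -> exists2 r : R, 1 <= r &
    forall x, r ^+ 2 < enorm x ^+ 2 -> A * (enorm x ^+ 2) `^ (- q) <= u0 x.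
  move=> A0; have [r rP] := decay A.
  exists (Num.max 1 r); first by rewrite le_max lexx.
  move=> x; rewrite ltr_sqr ?nnegrE ?enorm_ge0 ?le_max ?ler01// gt_max.
  move=> /andP[x1 rx]; have x0 : 0 < enorm x by exact: lt_trans x1.
  rewrite powRN ler_pdivrMr ?powR_gt0 ?exprn_gt0// mulrC.
  have := ltW (rP x rx); rewrite -(powR_mulrn 2 (ltW x0)) -powRrM.
  by rewrite mulrA mulr1.
have [r r1 rP] := decay' 1 ler01.
have r0 : 0 < r by exact: lt_le_trans r1.
have [dlt dlt0 dltP] : exists2 dlt, 0 < dlt & forall x, enorm x ^+ 2 <= r ^+ 2 ->
    dlt <= u x ((r ^+ 2 + 1) / m).
  apply: solution_positive => //; first exact: sqr_ge0.
  move=> R2; exists ((Num.max R2 1) `^ (- q)).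
    by rewrite powR_gt0// lt_max ltr01 orbT.
  move=> x /andP[rx xR]; apply: le_trans (rP x rx); rewrite (mul1r (_ `^ _)).
  apply: powRN_le; first exact: ltW.
    by rewrite (le_lt_trans _ rx)// sqr_ge0.
  by rewrite le_max xR.
pose T := (r ^+ 2 + 1) / m.
have T0 : 0 <= T by rewrite divr_ge0 ?(ltW m0)// addr_ge0// sqr_ge0.
have [K K0 uK] := solution_ge_expR.
exists T => // eps eps0.
have E0 : 0 < expR (- K * T) by exact: expR_gt0.
(* The inverse exponential compensates the loss up to time [T], leaving exactly [(eps * |x|^2)^(-q)]
   as lower bound for [u x T] outside radius [r']. *)
have [r' r'1 r'P] := decay' ((expR (- K * T))^-1 * eps `^ (- q))
  (mulr_ge0 (ltW (etrans (invr_gt0 _) E0)) (powR_ge0 _ _)).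
have r'0 : 0 < r' by exact: lt_le_trans r'1.
(* A lower bound for [u] at time [T] on the ball and the shell together; [c] is then chosen so that
   [c^(-q) = d]. *)
pose d := Num.min dlt (expR (- K * T) * (r' ^+ 2) `^ (- q)).
have d0 : 0 < d by rewrite lt_min dlt0 mulr_gt0// powR_gt0// exprn_gt0.
pose c := d `^ (- (p - 1)).
have c0 : 0 < c by rewrite powR_gt0.
have cq : c `^ (- q) = d.
  rewrite -powRrM (_ : - (p - 1) * - q = 1) ?powRr1 ?(ltW d0)//.
  by rewrite mulrNN mulrC.
exists c => // x t Tt.
apply: subsolution_le => //; [exact: ltW|exact: ltW|] => {x t Tt} x.
have eq0 : 0 <= q by exact: ltW.
have cd : (c + eps * enorm x ^+ 2) `^ (- q) <= d.
  by rewrite -cq; apply: powRN_le => //; rewrite lerDl mulr_ge0 ?sqr_ge0// ltW.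
have [xr|xr] := leP (enorm x ^+ 2) (r ^+ 2).
  by apply: (le_trans cd); rewrite ge_min (dltP x xr).
have [ux _] := uK x T T0; apply: le_trans ux.
have x2 : 0 < enorm x ^+ 2 by rewrite (le_lt_trans _ xr)// sqr_ge0.
have [xr'|xr'] := leP (enorm x ^+ 2) (r' ^+ 2).
  apply: (le_trans cd); rewrite /d ge_min; apply/orP; right.
  rewrite ler_pM2l//; apply: le_trans (rP x xr); rewrite (mul1r (_ `^ _)).
  exact: powRN_le.
have := r'P x xr'; rewrite -mulrA -ler_pdivlMl ?invr_gt0// invrK => H.
apply: le_trans H; rewrite -powRM ?(ltW eps0) ?(ltW x2)//.
apply: powRN_le => //; first by rewrite mulr_gt0.
by rewrite lerDr ltW.
Qed.

Lemma solution_limit : 0 < m ->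
  (forall A : R, exists r : R, forall x, r < enorm x ->
     A < enorm x `^ (2 / (p - 1)) * u0 x) ->
  (exists M : R, forall x, u0 x <= M) ->
  forall k e : R, 0 < k -> 0 < e ->
  exists t0 : R, forall x t, t0 < t -> enorm x <= k * Num.sqrt t ->
    `|t `^ q * u x t - q `^ q| <= e.
Proof.
move=> m0 decay [M u0M] k e k0 e0.
have p0 : 0 < p - 1 by rewrite subr_gt0.
have q0' := ltW q0.
have qq : q `^ q = (p - 1) `^ (- q).
  by rewrite powRN div1r -powR_inv1 ?(ltW p0)// -powRrM mulN1r powRN.
have scale (t A : R) : 0 < t -> 0 < A -> t `^ q * (t * A) `^ (- q) = A `^ (- q).
  move=> t0 A0; rewrite powRM ?ltW// mulrA powRN mulfV ?mul1r//.
  by rewrite gt_eqF// powR_gt0.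
(* Continuity of [y^(-q)] at [p - 1] turns the tolerance [e] into a tolerance [eta] on the
   coefficient of [t]. *)
have [eta eta0 etaP] : exists2 eta : R, 0 < eta &
    (p - 1) `^ (- q) - e <= (p - 1 + eta) `^ (- q).
  have [d _] := is_derive1_powR (- q) p0.
  have /differentiable_continuous/cvgrPdist_le/(_ e e0) :
      differentiable (fun y : R => y `^ (- q)) (p - 1) by exact/derivable1_diffP.
  move=> /nbhs_ballP[eta /= eta0 H]; exists (eta / 2); first by rewrite divr_gt0.
  have := H (p - 1 + eta / 2); rewrite /ball/= opprD addrA subrr sub0r normrN.
  rewrite gtr0_norm ?divr_gt0// ltr_pdivrMr// ltr_pMr// ltr1n => /(_ isT).
  by rewrite ler_norml => /andP[_]; lra.
have [T T0 lower] := solution_lower_profile m0 decay.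
(* On [|x| <= k sqrt t] the [eps] terms add up to at most [eps * S * t], set equal to half of
   [eta * t]. The other half absorbs [c] once [t > 2 c / eta]. *)
pose S := k ^+ 2 + m.
have S0 : 0 < S by rewrite addr_gt0// exprn_gt0.
pose eps := eta / 2 / S.
have eps0 : 0 < eps by rewrite !divr_gt0.
have epsS : eps * S = eta / 2 by rewrite divfK// gt_eqF.
have [c c0 cP] := lower eps eps0.
exists (Num.max (Num.max 1 T) (2 * c / eta)) => x t.
rewrite !gt_max -andbA => /and3P[t1 Tt ct] xk.
have t0 : 0 < t by exact: lt_trans t1.
rewrite qq ler_distl; apply/andP; split.
  have B0 : 0 <= p - 1 + eps * m.
    exact: addr_ge0 (ltW p0) (mulr_ge0 (ltW eps0) (ltW m0)).
  have tT : 0 <= t - T by rewrite subr_ge0 ltW.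
  apply: (le_trans etaP).
  rewrite -(scale t _ t0 (addr_gt0 p0 eta0)) ler_wpM2l ?powR_ge0//.
  apply: le_trans (cP x t (ltW Tt)); apply: powRN_le => //.
    rewrite -addrA ltr_pwDl//.
    exact: addr_ge0 (mulr_ge0 (ltW eps0) (sqr_ge0 _)) (mulr_ge0 B0 tT).
  have x2 : enorm x ^+ 2 <= k ^+ 2 * t.
    rewrite -[t in leRHS]sqr_sqrtr ?(ltW t0)// -exprMn.
    by rewrite ler_sqr ?nnegrE ?enorm_ge0 ?mulr_ge0 ?sqrtr_ge0 ?(ltW k0).
  have ex := ler_wpM2l (ltW eps0) x2.
  have c2 : c <= t * (eta / 2).
    by move: ct; rewrite ltr_pdivrMr// => /ltW; lra.
  have mT : 0 <= (p - 1 + eps * m) * T by rewrite mulr_ge0.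
  have St : t * (eps * S) = t * (eta / 2) by rewrite epsS.
  rewrite /S in St; lra.
have M0 : 0 < Num.max M 1 by rewrite lt_max ltr01 orbT.
(* Chosen so that [c'^(-q)] is the positive upper bound [Num.max M 1] of [u0]. Dropping [c'] later
   leaves [t^q u <= (p - 1)^(-q)] with no error term. *)
pose c' := (Num.max M 1) `^ (- (p - 1)).
have c'0 : 0 < c' by rewrite powR_gt0.
have uc : u x t <= (c' + (p - 1) * t) `^ (- q).
  apply: supersolution_ge => //; last exact: ltW.
  move=> y; rewrite -powRrM (_ : - (p - 1) * - q = 1).
    by rewrite powRr1 ?(ltW M0)// le_max u0M.
  by rewrite mulrNN mulrC.
apply: (@le_trans _ _ ((p - 1) `^ (- q))); last by rewrite lerDl ltW.
rewrite -[leRHS](scale t)// ler_wpM2l ?powR_ge0//; apply: (le_trans uc).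
apply: powRN_le => //; first by rewrite mulr_gt0.
by rewrite mulrC lerDr ltW.
Qed.

End solution.

(** * Passage to the supremum over the parabolic sets *)

Theorem theorem5p1 (R : realType) (N : nat) (p : R) (J u0 : 'rV[R]_N -> R)
    (u : 'rV[R]_N -> R -> R) :
  (1 <= N)%N -> 1 < p ->
  smooth J -> compactly_supported J -> radially_symmetric J ->
  (forall x, 0 <= J x) ->
  (\int[lebesgue_mu R N]_x (J x)%:E = 1)%E ->
  (forall x, 0 <= u0 x) ->
  measurable_fun [set: lebesgue_space R N] (u0 : lebesgue_space R N -> R) ->
  (exists M : R, forall x, u0 x <= M) ->
  (forall A : R, exists r : R, forall x, r < enorm x ->
     A < enorm x `^ (2 / (p - 1)) * u0 x) ->
  bounded_solution p J u0 u ->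
  forall k : R, 0 < k ->
    ereal_sup [set (`| t `^ (1 / (p - 1)) * u x t
                       - (1 / (p - 1)) `^ (1 / (p - 1)) |)%:E
              | x in [set x | enorm x <= k * Num.sqrt t]]
      @[t --> +oo] --> 0%E.
Proof.
move=> N1 p1 sJ cJ rJ J0 J1 _ _ u0M decay hu k k0.
have kJ : diffusion_kernel J by split => //; exact: (sJ 0).
have m0 := second_moment_gt0 kJ N1.
set F := (X in X @ _ --> _).
(* The origin belongs to the set, so the supremum is not the value [-oo] of an empty one. *)
have F0 t : 0 <= k * Num.sqrt t -> (0 <= F t)%E.
  move=> kt; apply: ereal_sup_ge.
  by eexists; [exists 0; [rewrite /= enorm0|reflexivity]|rewrite lee_fin].
have Fe e : 0 < e -> \forall t \near +oo, (0 <= F t <= e%:E)%E.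
  move=> e0; have [t0 H] := solution_limit p1 kJ hu m0 decay u0M k0 e0.
  near=> t; apply/andP; split.
    by apply: F0; rewrite mulr_ge0 ?sqrtr_ge0 ?ltW.
  apply: ge_ereal_sup => _ [x xt <-]; rewrite lee_fin; apply: H => //.
  by near: t; apply: nbhs_pinfty_gt; rewrite num_real.
(* Tolerance 1 already makes the extended supremum finite for large [t]; the limit is then a real
   one. *)
apply/fine_cvgP; split.
  near=> t; have : (0 <= F t <= 1%:E)%E by near: t; exact: Fe.
  move=> /andP[F0t F1t]; rewrite ge0_fin_numE//.
  by rewrite (le_lt_trans F1t)// ltry.
apply/cvgrPdist_le => e e0; near=> t.
have /andP[F0t Fet] : (0 <= F t <= e%:E)%E by near: t; exact: Fe.
rewrite sub0r normrN /= ger0_norm ?fine_ge0//.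
rewrite -lee_fin fineK// ge0_fin_numE//.
by rewrite (le_lt_trans Fet)// ltry.
Unshelve. all: by end_near. Qed.
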